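(* Let $C\in\left[\frac{25-\sqrt{105}}{780},\ \frac{25+\sqrt{105}}{780}\right]$ and $D=-C$. Then the implicit two-stage fourth-order scheme with parameters $C,D$ is L-stable; that is, its amplification factor $R(z;C)$ satisfies $$\sup_{\operatorname{Re}(z)\le 0}|R(z;C)|\le 1\qquad\text{and}\qquad \lim_{\substack{|z|\to\infty\\ \operatorname{Re}(z)\le 0}}R(z;C)=0 .$$
   Context: The implicit two-stage fourth-order scheme with real parameters $C,D$ for $u_t=\mathcal{L}(u)$, with $\mathcal{G}(u)=\frac{\partial}{\partial t}\mathcal{L}(u)=\mathcal{L}_u(u)\mathcal{L}(u)$, is $$u^{n+1/2}=u^n+\tfrac{\Delta t}{4}[\mathcal{L}(u^n)+\mathcal{L}(u^{n+1/2})]+\tfrac{\Delta t^2}{48}[\mathcal{G}(u^n)-\mathcal{G}(u^{n+1/2})],$$ $$\begin{aligned}u^{n+1}=u^n&+\Delta t\left[(\tfrac16+4C+\tfrac12D)\mathcal{L}(u^n)+(\tfrac23-8C+2D)\mathcal{L}(u^{n+1/2})+(\tfrac16+4C-\tfrac52D)\mathcal{L}(u^{n+1})\right]\\&+\Delta t^2\left[C\,\mathcal{G}(u^n)+D\,\mathcal{G}(u^{n+1/2})+(\tfrac12D-C)\mathcal{G}(u^{n+1})\right].\end{aligned}$$ Applied to the scalar test equation $u_t=\lambda u$ with $z=\lambda\Delta t\in\mathbb{C}$, so that $\mathcal{L}(u)=\lambda u$ and $\mathcal{G}(u)=\lambda^2u$, it gives $u^{n+1}=R\,u^n$. For $D=-C$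 the amplification factor is $$R(z;C)=\frac{1+z\left[\frac16+\frac72C+\left(\frac23-10C\right)G(z)\right]+Cz^2\left[1-G(z)\right]}{1-\left(\frac16+\frac{13}{2}C\right)z+\frac32Cz^2},\qquad G(z)=\frac{1+\frac z4+\frac{z^2}{48}}{1-\frac z4+\frac{z^2}{48}}.$$ *)

(* Defs.v *)
From Stdlib Require Import Reals Lra.
From Coquelicot Require Import Coquelicot.

Open Scope R_scope.

(** Here [C] is Coquelicot's type of complex numbers, and the real parameters
    [C] and [D] of the scheme are written [c] and [d]. *)

Section Scheme.

Variables (L : C -> C) (c d dt : R).

Local Open Scope C_scope.

(** Chain rule: along a solution of [u_t = L u], the time derivative of [L u]
    is [L_u u * L u]. *)
Definition time_derivative (u : C) : C := C_derive L u * L u.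

Local Notation G := time_derivative.

(** [u0], [uh], [u1] stand for the values at the levels n, n+1/2, n+1.  Both
    stages are implicit, so each is a relation and not a function of [u0]. *)

Definition half_stage (u0 uh : C) : Prop :=
  uh = u0 + RtoC (dt / 4) * (L u0 + L uh)
          + RtoC (dt ^ 2 / 48) * (G u0 - G uh).

Definition full_stage (u0 uh u1 : C) : Prop :=
  u1 = u0 + RtoC dt *
              (RtoC (1 / 6 + 4 * c + 1 / 2 * d) * L u0
               + RtoC (2 / 3 - 8 * c + 2 * d) * L uh
               + RtoC (1 / 6 + 4 * c - 5 / 2 * d) * L u1)
          + RtoC (dt ^ 2) *
              (RtoC c * G u0 + RtoC d * G uh + RtoC (1 / 2 * d - c) * G u1).

Definition two_stage_step (u0 u1 : C) : Prop :=
  exists uh : C, half_stage u0 uh /\ full_stage u0 uh u1.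

End Scheme.

(** On the test equation [u_t = lambda u] with [z = lambda dt] in the closed
    left half-plane, the step from [u0] is solvable and every solution is
    [S z * u0].  In particular this excludes a pole of the factor in that
    half-plane, which the total division of [C] would otherwise hide. *)
Definition is_amplification_factor (c d : R) (S : C -> C) : Prop :=
  forall (lambda : C) (dt : R),
    0 < dt -> Re (lambda * RtoC dt)%C <= 0 ->
    forall u0 u1 : C,
      two_stage_step (fun u => (lambda * u)%C) c d dt u0 u1
      <-> u1 = (S (lambda * RtoC dt) * u0)%C.

Definition half_factor (z : C) : C :=
  ((1 + z / 4 + z ^ 2 / 48) / (1 - z / 4 + z ^ 2 / 48))%C.

Definition amplification_factor (c : R) (z : C) : C :=
  ((1 + z * (RtoC (1 / 6 + 7 / 2 * c)
             + RtoC (2 / 3 - 10 * c) * half_factor z)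
      + RtoC c * z ^ 2 * (1 - half_factor z))
   / (1 - RtoC (1 / 6 + 13 / 2 * c) * z + RtoC (3 / 2 * c) * z ^ 2))%C.

Definition left_half_plane (z : C) : Prop := Re z <= 0.

(** The filter [|z| -> oo] on the complex plane. *)
Definition C_infty : (C -> Prop) -> Prop :=
  fun P => exists M : R, forall z : C, M < Cmod z -> P z.

Global Instance C_infty_filter : Filter C_infty.
Proof.
split.
- now exists 0.
- intros P Q [M HM] [N HN]; exists (Rmax M N); intros z Hz; split.
  + apply HM; apply Rle_lt_trans with (2 := Hz); apply Rmax_l.
  + apply HN; apply Rle_lt_trans with (2 := Hz); apply Rmax_r.
- intros P Q HPQ [M HM]; exists M; auto.
Qed.

Global Instance within_left_half_plane_C_infty_proper :
  ProperFilter (within left_half_plane C_infty).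
Proof.
split; [| apply within_filter, C_infty_filter].
intros P [M HM].
assert (H0 : 0 <= Rabs M + 1) by (pose proof (Rabs_pos M); lra).
exists (RtoC (- (Rabs M + 1))); apply HM.
- rewrite Cmod_R, Rabs_Ropp, Rabs_pos_eq by exact H0.
  pose proof (Rle_abs M); lra.
- unfold left_half_plane; simpl; lra.
Qed.

(* Main.v *)
(** Over a common denominator the factor is [N / (P Q)] with [P], [Q] quadratic
    and free of zeros in the left half-plane, and with [deg N = 3], because the
    [z^4] terms of [N] cancel; hence the decay at infinity.  For the bound,
    expand [|P Q|^2 - |N|^2] at [z = - t + i y] as a polynomial in [t] and
    [y^2].  On the given interval of [c] every coefficient is nonnegative, so
    no maximum principle is needed; the coefficient of [y^6] is
    [(- 1170 c^2 + 75 c - 1) / 3456], whose roots are the end points of the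
    interval. *)

Require Import Defs.
From Stdlib Require Import Reals Lra.
From Coquelicot Require Import Coquelicot.
Open Scope R_scope.

(** * Algebra over the complex numbers *)

(** On the test equation this turns [time_derivative] into multiplication by [lambda ^ 2]. *)
Lemma C_derive_mult_l (a u : C) : C_derive (fun v => a * v)%C u = a.
Proof.
apply is_C_derive_unique.
apply is_derive_ext with (f := fun v : C => scal v a).
- intros v; apply Cmult_comm.
- assert (H := is_derive_scal_l (K := C_AbsRing) (V := C_NormedModule)
    (fun v => v) u one a (is_derive_id u)).
  now rewrite scal_one in H.
Qed.

Lemma Cmult_eq_reg_r (p x y : C) : (x * p = y * p)%C -> p <> 0%C -> x = y.
Proof.
intros H Hp.
replace x with (x * p / p)%C by (field; exact Hp).
rewrite H; field; exact Hp.
Qed.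

(** At a zero [x + i y] the imaginary part gives [y * (a - 2 * b * x) = 0]. For [x <= 0] the second
    factor is positive, so [y = 0], and then the real part [1 - a x + b x^2] is at least 1. *)
Lemma quadratic_neq_0 (a b : R) (z : C) :
  0 < a -> 0 <= b -> Re z <= 0 -> (1 - RtoC a * z + RtoC b * z ^ 2)%C <> 0%C.
Proof.
destruct z as [x y]; simpl; intros Ha Hb Hx H.
injection H; intros Him Hre.
assert (Hy : y * (a - 2 * b * x) = 0) by lra.
apply Rmult_integral in Hy; destruct Hy as [-> | Hy]; nra.
Qed.

(** * The factor as a single fraction *)

Definition half_den (z : C) : C := (1 - RtoC (1 / 4) * z + RtoC (1 / 48) * z ^ 2)%C.

Definition full_den (c : R) (z : C) : C :=
  (1 - RtoC (1 / 6 + 13 / 2 * c) * z + RtoC (3 / 2 * c) * z ^ 2)%C.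

(** The numerator N over the common denominator P Q, where P is [half_den] and Q is [full_den]. *)
Definition factor_num (c : R) (z : C) : C :=
  (1 + RtoC (7 / 12 - 13 / 2 * c) * z + RtoC (7 / 48 - 27 / 8 * c) * z ^ 2
   + RtoC (5 / 288 - 61 / 96 * c) * z ^ 3)%C.

Lemma half_den_neq_0 (z : C) : left_half_plane z -> half_den z <> 0%C.
Proof. intros Hz; apply quadratic_neq_0; try lra; exact Hz. Qed.

Lemma full_den_neq_0 (c : R) (z : C) :
  0 < c -> left_half_plane z -> full_den c z <> 0%C.
Proof. intros Hc Hz; apply quadratic_neq_0; try lra; exact Hz. Qed.

Lemma half_factor_eq (z : C) :
  half_factor z = ((1 + RtoC (1 / 4) * z + RtoC (1 / 48) * z ^ 2) / half_den z)%C.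
Proof.
unfold half_factor, half_den; f_equal; [|f_equal];
  rewrite !RtoC_div by lra; field; split; intros H; injection H; lra.
Qed.

Lemma amplification_factor_eq (c : R) (z : C) :
  0 < c -> left_half_plane z ->
  amplification_factor c z = (factor_num c z / (half_den z * full_den c z))%C.
Proof.
intros Hc Hz.
pose proof (half_den_neq_0 z Hz) as HP; pose proof (full_den_neq_0 c z Hc Hz) as HQ.
unfold amplification_factor; rewrite half_factor_eq.
fold (full_den c z).
apply Cmult_eq_reg_r with (half_den z * full_den c z)%C.
2: now apply Cmult_neq_0.
transitivity (factor_num c z); [|field; now split].
set (Q := full_den c z) in *.
unfold factor_num.
(* Clearing both denominators leaves this polynomial, whose two [z ^ 4] terms, [c / 48] and
   [- c / 48], cancel. *)
transitivity ((1 + RtoC (1 / 6 + 7 / 2 * c) * z + RtoC c * z ^ 2) * half_den z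
   + (RtoC (2 / 3 - 10 * c) * z - RtoC c * z ^ 2)
     * (1 + RtoC (1 / 4) * z + RtoC (1 / 48) * z ^ 2))%C.
- field; now split.
- unfold half_den; destruct z as [x y].
  apply injective_projections; simpl; field.
Qed.

(** * The bound by 1 *)

(** At [t = 0] the expansion starts with [y ^ 6], in keeping with fourth-order accuracy. *)
Definition modulus_gap (c t y : R) : R :=
  (- 1170 * c ^ 2 + 75 * c - 1) / 3456 * y ^ 6
  + c ^ 2 / 1024 * y ^ 8
  + 2 * t
  + (6084 * c ^ 2 - 120 * c + 7) / 72 * (t * y ^ 2)
  + (21636 * c ^ 2 - 1020 * c + 19) / 3456 * (t * y ^ 4)
  + (147 * c ^ 2 + c) / 4608 * (t * y ^ 6)
  + (78 * c - 1) / 3 * t ^ 2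
  + (- 468 * c ^ 2 + 342 * c - 5) / 144 * (t ^ 2 * y ^ 2)
  + (- 720 * c ^ 2 + 84 * c - 1) / 1152 * (t ^ 2 * y ^ 4)
  + c ^ 2 / 256 * (t ^ 2 * y ^ 6)
  + (6084 * c ^ 2 - 192 * c + 19) / 72 * t ^ 3
  + (24444 * c ^ 2 - 840 * c + 19) / 1728 * (t ^ 3 * y ^ 2)
  + (147 * c ^ 2 + c) / 1536 * (t ^ 3 * y ^ 4)
  + (- 468 * c ^ 2 + 414 * c - 5) / 144 * t ^ 4
  + (- 270 * c ^ 2 + 93 * c - 1) / 1152 * (t ^ 4 * y ^ 2)
  + 3 * c ^ 2 / 512 * (t ^ 4 * y ^ 4)
  + (27252 * c ^ 2 - 660 * c + 19) / 3456 * t ^ 5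
  + (147 * c ^ 2 + c) / 1536 * (t ^ 5 * y ^ 2)
  + (180 * c ^ 2 + 102 * c - 1) / 3456 * t ^ 6
  + c ^ 2 / 256 * (t ^ 6 * y ^ 2)
  + (147 * c ^ 2 + c) / 4608 * t ^ 7
  + c ^ 2 / 1024 * t ^ 8.

Lemma modulus_gap_correct (c x y : R) :
  Cmod (half_den (x, y) * full_den c (x, y)) ^ 2 - Cmod (factor_num c (x, y)) ^ 2
  = modulus_gap c (- x) y.
Proof.
rewrite !Cmod2_alt; unfold modulus_gap, half_den, full_den, factor_num; simpl.
field.
Qed.

(** The quadratic hypothesis is the sign of the [y ^ 6] coefficient; the other coefficients are
    already nonnegative on the rational interval. Only even powers of [y] occur. *)
Lemma modulus_gap_ge_0 (c t y : R) :
  18 / 1000 <= c <= 46 / 1000 -> 0 <= - 1170 * c ^ 2 + 75 * c - 1 -> 0 <= t ->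
  0 <= modulus_gap c t y.
Proof.
intros Hc Hq Ht.
assert (Ht2 := fun n => pow_le t n Ht).
assert (Hy : forall k, 0 <= y ^ (2 * k))
  by (intros k; rewrite pow_mult; apply pow_le, pow2_ge_0).
pose proof (Hy 1%nat); pose proof (Hy 2%nat); pose proof (Hy 3%nat); pose proof (Hy 4%nat).
unfold modulus_gap.
repeat apply Rplus_le_le_0_compat;
  repeat match goal with |- 0 <= _ * _ => apply Rmult_le_pos end;
  try apply Ht2; try assumption; nra.
Qed.

Lemma parameter_interval (c : R) :
  (25 - sqrt 105) / 780 <= c <= (25 + sqrt 105) / 780 ->
  18 / 1000 <= c <= 46 / 1000 /\ 0 <= - 1170 * c ^ 2 + 75 * c - 1.
Proof.
intros Hc.
assert (Hs : sqrt 105 * sqrt 105 = 105) by (apply sqrt_sqrt; lra).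
pose proof (sqrt_pos 105) as Hp.
(* This estimate is sharp enough for the bounds 0.018 and 0.046. *)
assert (sqrt 105 <= 103 / 10) by nra.
split; [lra|].
(* The product equals [520 * (- 1170 * c ^ 2 + 75 * c - 1)]. *)
assert (0 <= (780 * c - (25 - sqrt 105)) * ((25 + sqrt 105) - 780 * c))
  by (apply Rmult_le_pos; lra).
nra.
Qed.

Lemma amplification_factor_le_1 (c : R) (z : C) :
  18 / 1000 <= c <= 46 / 1000 -> 0 <= - 1170 * c ^ 2 + 75 * c - 1 ->
  left_half_plane z -> Cmod (amplification_factor c z) <= 1.
Proof.
intros Hc Hq Hz.
rewrite amplification_factor_eq by (try assumption; lra).
assert (HD : (half_den z * full_den c z)%C <> 0%C).
{ apply Cmult_neq_0; [now apply half_den_neq_0 | apply full_den_neq_0; [lra | exact Hz]]. }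
rewrite Cmod_div by exact HD.
apply Rle_div_l; [now apply Cmod_gt_0|].
rewrite Rmult_1_l.
apply Rsqr_incr_0; try apply Cmod_ge_0.
destruct z as [x y].
pose proof (modulus_gap_correct c x y) as HE.
assert (0 <= modulus_gap c (- x) y)
  by (apply modulus_gap_ge_0; auto; unfold left_half_plane in Hz; simpl in Hz; lra).
rewrite !Rsqr_pow2; lra.
Qed.

(** * Solving the two stages on the test equation *)

(* Solves a stage that is implicit in [x], where [A] depends affinely on [x]. *)
Lemma eq_affine_iff (p x A B : C) :
  p <> 0%C -> (x - A = x * p - B)%C -> (x = A <-> x = B / p)%C.
Proof.
intros Hp H; split; intros Hx.
- apply Cmult_eq_reg_r with p; [|exact Hp].
  transitivity (x - A + B)%C; [rewrite H; ring|].
  rewrite Hx; field; exact Hp.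
- transitivity (x - A + A)%C; [ring|].
  rewrite H, Hx; field; exact Hp.
Qed.

Lemma half_stage_iff (lambda u0 uh : C) (dt : R) :
  left_half_plane (lambda * RtoC dt)%C ->
  half_stage (fun u => (lambda * u)%C) dt u0 uh
  <-> uh = (half_factor (lambda * RtoC dt) * u0)%C.
Proof.
intros Hz; pose proof (half_den_neq_0 _ Hz) as HP.
rewrite half_factor_eq.
unfold half_stage, time_derivative; rewrite !C_derive_mult_l.
set (N := (1 + _ + _)%C).
replace (N / half_den (lambda * RtoC dt) * u0)%C
  with (N * u0 / half_den (lambda * RtoC dt))%C by (field; exact HP).
apply eq_affine_iff; [exact HP|].
unfold N, half_den.
destruct lambda, u0, uh; apply injective_projections; simpl; field.
Qed.

Lemma full_stage_iff (lambda u0 uh u1 : C) (c dt : R) :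
  0 < c -> left_half_plane (lambda * RtoC dt)%C ->
  let z := (lambda * RtoC dt)%C in
  full_stage (fun u => (lambda * u)%C) c (- c) dt u0 uh u1
  <-> u1 = (((1 + RtoC (1 / 6 + 7 / 2 * c) * z + RtoC c * z ^ 2) * u0
             + (RtoC (2 / 3 - 10 * c) * z - RtoC c * z ^ 2) * uh) / full_den c z)%C.
Proof.
intros Hc Hz z; pose proof (full_den_neq_0 c z Hc Hz) as HQ.
unfold full_stage, time_derivative; rewrite !C_derive_mult_l.
apply eq_affine_iff; [exact HQ|].
unfold full_den, z.
destruct lambda, u0, uh, u1; apply injective_projections; simpl; field.
Qed.

Lemma amplification_factor_correct (c : R) :
  0 < c -> is_amplification_factor c (- c) (amplification_factor c).
Proof.
intros Hc lambda dt _ Hz u0 u1.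
set (z := (lambda * RtoC dt)%C) in *.
pose proof (full_den_neq_0 c z Hc Hz) as HQ.
(* Separating the contributions of [u0] and of the half-stage value gives the form of
   [full_stage_iff]. *)
assert (HS : (amplification_factor c z * u0 =
  ((1 + RtoC (1 / 6 + 7 / 2 * c) * z + RtoC c * z ^ 2) * u0
   + (RtoC (2 / 3 - 10 * c) * z - RtoC c * z ^ 2) * (half_factor z * u0))
  / full_den c z)%C).
{ unfold amplification_factor; fold (full_den c z); field; exact HQ. }
rewrite HS; split.
- intros [uh [Hh Hf]].
  apply half_stage_iff in Hh; [|exact Hz]; fold z in Hh; rewrite <- Hh.
  now apply full_stage_iff in Hf.
- intros H; exists (half_factor z * u0)%C; split.
  + now apply half_stage_iff.
  + now apply full_stage_iff.
Qed.

(** * Decay at infinity *)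

(** The lower-order terms are at most [(a + 1) |z|] since [|z| >= 1], and the second threshold makes
    this at most half of [b |z|^2]. *)
Lemma Cmod_quadratic_ge (a b : R) (z : C) :
  0 < a -> 0 < b -> 1 <= Cmod z -> 2 * (a + 1) / b <= Cmod z ->
  b / 2 * Cmod z ^ 2 <= Cmod (1 - RtoC a * z + RtoC b * z ^ 2).
Proof.
intros Ha Hb H1 H.
apply Rle_div_l in H; [|exact Hb].
assert (Ht : b * Cmod z ^ 2 <= Cmod (1 - RtoC a * z + RtoC b * z ^ 2) + (a * Cmod z + 1)).
{ replace (b * Cmod z ^ 2) with (Cmod (RtoC b * z ^ 2)).
  2: now rewrite Cmod_mult, Cmod_pow, Cmod_R, Rabs_pos_eq by lra.
  replace (a * Cmod z + 1) with (Cmod (RtoC a * z) + Cmod (- (1))).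
  2: now rewrite Cmod_mult, Cmod_opp, Cmod_R, Cmod_1, Rabs_pos_eq by lra.
  replace (RtoC b * z ^ 2)%C
    with ((1 - RtoC a * z + RtoC b * z ^ 2) + (RtoC a * z + - (1)))%C at 1 by ring.
  eapply Rle_trans; [apply Cmod_triangle|].
  apply Rplus_le_compat_l, Cmod_triangle. }
nra.
Qed.

Lemma Cmod_cubic_le (a b d : R) (z : C) :
  1 <= Cmod z ->
  Cmod (1 + RtoC a * z + RtoC b * z ^ 2 + RtoC d * z ^ 3)
  <= (1 + Rabs a + Rabs b + Rabs d) * Cmod z ^ 3.
Proof.
intros H1.
eapply Rle_trans; [apply Cmod_triangle|].
eapply Rle_trans; [apply Rplus_le_compat_r, Cmod_triangle|].
eapply Rle_trans; [apply Rplus_le_compat_r, Rplus_le_compat_r, Cmod_triangle|].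
rewrite !Cmod_mult, !Cmod_pow, !Cmod_R, Rabs_R1, !Rmult_plus_distr_r.
pose proof (Rle_pow (Cmod z) 0 3 H1 ltac:(repeat constructor)) as H03.
pose proof (Rle_pow (Cmod z) 1 3 H1 ltac:(repeat constructor)) as H13.
pose proof (Rle_pow (Cmod z) 2 3 H1 ltac:(repeat constructor)) as H23.
rewrite pow_O in H03; rewrite pow_1 in H13.
pose proof (Rmult_le_compat_l _ _ _ (Rabs_pos a) H13).
pose proof (Rmult_le_compat_l _ _ _ (Rabs_pos b) H23).
lra.
Qed.

Lemma amplification_factor_lim (c : R) :
  0 < c ->
  filterlim (amplification_factor c)
    (within left_half_plane C_infty) (locally (RtoC 0)).
Proof.
intros Hc P [eps HP].
set (K := 1 + Rabs (7 / 12 - 13 / 2 * c) + Rabs (7 / 48 - 27 / 8 * c)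
          + Rabs (5 / 288 - 61 / 96 * c)).
set (M1 := 2 * (1 / 4 + 1) / (1 / 48)).
set (M2 := 2 * (1 / 6 + 13 / 2 * c + 1) / (3 / 2 * c)).
(* [M1] and [M2] are the thresholds for P and Q. Beyond them [|P Q| >= c / 128 * |z|^4], where
   [1 / 128 = 1 / 96 * 3 / 4], so the factor is at most [128 K / (c |z|)]; the last bound makes this
   less than [eps]. *)
exists (Rmax (Rmax 1 M1) (Rmax M2 (128 * K / c / eps))).
intros z HM Hz.
apply Rmax_Rlt in HM; destruct HM as [HM HM'].
apply Rmax_Rlt in HM; destruct HM as [H1 HM1].
apply Rmax_Rlt in HM'; destruct HM' as [HM2 HM3].
apply -> Rlt_div_l in HM3; [|apply cond_pos].
apply -> Rlt_div_l in HM3; [|exact Hc].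
assert (HR : Cmod (amplification_factor c z) < eps).
{ rewrite amplification_factor_eq by assumption.
  rewrite Cmod_div by (apply Cmult_neq_0; [now apply half_den_neq_0 | now apply full_den_neq_0]).
  assert (HN : Cmod (factor_num c z) <= K * Cmod z ^ 3)
    by (apply Cmod_cubic_le; lra).
  assert (HP1 : 1 / 48 / 2 * Cmod z ^ 2 <= Cmod (half_den z))
    by (apply Cmod_quadratic_ge; fold M1; lra).
  assert (HQ1 : 3 / 2 * c / 2 * Cmod z ^ 2 <= Cmod (full_den c z))
    by (apply Cmod_quadratic_ge; fold M2; lra).
  assert (Hm : 0 < Cmod z ^ 3) by (apply pow_lt; lra).
  assert (Hm2 : 0 < Cmod z ^ 2) by (apply pow_lt; lra).
  assert (HD : c / 128 * Cmod z ^ 4 <= Cmod (half_den z * full_den c z)).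
  { rewrite Cmod_mult.
    replace (c / 128 * Cmod z ^ 4)
      with ((1 / 48 / 2 * Cmod z ^ 2) * (3 / 2 * c / 2 * Cmod z ^ 2)) by field.
    apply Rmult_le_compat; try assumption; apply Rmult_le_pos; lra. }
  assert (HD0 : 0 < c / 128 * Cmod z ^ 4)
    by (apply Rmult_lt_0_compat; [lra | apply pow_lt; lra]).
  apply Rlt_div_l; [lra|].
  apply Rle_lt_trans with (1 := HN).
  apply Rlt_le_trans with (eps * (c / 128 * Cmod z ^ 4)).
  2: apply Rmult_le_compat_l; [apply Rlt_le, cond_pos | exact HD].
  apply Rlt_le_trans with ((Cmod z * eps * c / 128) * Cmod z ^ 3); [|right; field].
  apply Rmult_lt_compat_r; lra. }
apply HP.
(* Balls in [C] are taken coordinatewise here, so each coordinate is bounded by the modulus. *)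
pose proof (Rmax_Cmod (amplification_factor c z)) as Hmax.
destruct (amplification_factor c z) as [x y]; simpl in Hmax.
split; [change (Rabs (x - 0) < eps) | change (Rabs (y - 0) < eps)]; rewrite Rminus_0_r.
- eapply Rle_lt_trans; [|exact HR]; eapply Rle_trans; [apply Rmax_l|exact Hmax].
- eapply Rle_lt_trans; [|exact HR]; eapply Rle_trans; [apply Rmax_r|exact Hmax].
Qed.

Theorem mainTheorem2 :
  forall c d : R,
    (25 - sqrt 105) / 780 <= c <= (25 + sqrt 105) / 780 ->
    d = - c ->
    is_amplification_factor c d (amplification_factor c)
    /\ Rbar_le
         (Lub_Rbar (fun r : R => exists z : C,
            left_half_plane z /\ r = Cmod (amplification_factor c z)))
         (Finite 1)
    /\ filterlim (amplification_factor c)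
         (within left_half_plane C_infty) (locally (RtoC 0)).
Proof.
intros c d Hc ->; apply parameter_interval in Hc; destruct Hc as [Hc Hq].
split; [apply amplification_factor_correct; lra|].
split; [|apply amplification_factor_lim; lra].
apply Lub_Rbar_correct.
intros r [z [Hz ->]]; now apply amplification_factor_le_1.
Qed.
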